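(* Let $G$ be a finite insoluble group, and let $x$ be any element of $G$ such that $|\mathrm{Sol}_G(x)|=3p$ where $p$ is a prime. Then $o(x)=p$, $p\equiv 1 \pmod 3$ and $\mathrm{Sol}_G(x)=N_G(\langle x\rangle)$.
   Context: For a finite group $G$ and $x \in G$, the solubilizer of $x$ in $G$ is the subset $\mathrm{Sol}_G(x)=\{y \in G \mid \langle x,y\rangle \text{ is soluble}\}$ (not a subgroup in general). Insoluble means not soluble. $o(x)$ denotes the order of $x$, and $N_G(H)$ the normalizer in $G$ of a subgroup $H$. *)

(* Defs.v *)
From mathcomp Require Import all_boot all_fingroup all_solvable.
Set Implicit Arguments.
Unset Strict Implicit.
Unset Printing Implicit Defensive.

Import GroupScope.

Definition solubilizer (gT : finGroupType) (G : {set gT}) (x : gT) : {set gT} :=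
  [set y in G | solvable <<[set x; y]>>].

(* Main.v *)
(* Write X = <x>, N = N_G(X) and S = Sol(x).  Every soluble subgroup of G
   containing x lies in S; S is a union of cosets of X, so o(x) divides 3p; and
   each prime order of an element of N divides |S|.
   - If o(x) = 3p then S = X, so X is an abelian maximal subgroup of any minimal
     insoluble subgroup containing x, which is impossible.
   - If a Sylow subgroup P containing x has N_G(P) <= C_G(P), transfer gives a
     normal complement K, and each Sylow subgroup Q of K normalised by x satisfies
     QX <= S; in all cases at hand this makes |K| divisible by few primes, so
     that G is soluble by Burnside.
   - If o(x) = p, then |S| / p = |N| / p modulo p, and this together with the
     previous point forces |N| = 3p and |N : C_N(X)| = 3, which divides p - 1.
   - If o(x) = 3 and p <> 3, then X is a Sylow subgroup.  When N <= C_G(X) the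
     second point applies, unless X = N; then x acts on K without fixed points, so
     that <x, y> is soluble for every y.  Otherwise N has even order, so p = 2 and
     S = N has order 6.  The triangle group (3,3,3) being soluble, x^-1 x^-1 is
     the only expression of x as a product of two conjugates of x, and the class
     algebra constant formula gives |G| < 9. *)
Require Import Defs.
From mathcomp Require Import all_boot all_fingroup all_solvable.
From mathcomp Require Import all_order all_algebra all_field all_character.
Set Implicit Arguments.
Unset Strict Implicit.
Unset Printing Implicit Defensive.

Import GroupScope.

(** * Fusion in abelian Sylow subgroups and Burnside's transfer theorem *)

(** [P] and [P :^ y] are abelian and contain [u ^ y], so both are Sylow in its centraliser, where
    some [c] carries one to the other; then [y * c] normalises [P] and hence fixes [u]. *)
Lemma Sylow_abelian_fusion p (gT : finGroupType) (G P : {group gT}) u y :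
    p.-Sylow(G) P -> 'N_G(P) \subset 'C(P) -> y \in G -> u \in P -> u ^ y \in P ->
  u ^ y = u.
Proof.
move=> sylP sNC Gy Pu Puy; have [sPG _ _] := and3P sylP.
have cPP: abelian P by rewrite /abelian (subset_trans _ sNC) // subsetI sPG normG.
have sylC (Q : {group gT}): p.-Sylow(G) Q -> abelian Q -> u ^ y \in Q ->
    p.-Sylow('C_G[u ^ y]) Q.
  move=> sylQ cQQ Quy; apply: (pHall_subl _ (subsetIl _ _) sylQ).
  by rewrite subsetI (pHall_sub sylQ) sub_cent1 (subsetP cQQ).
have sylPy: p.-Sylow(G) (P :^ y) by rewrite -(conjGid Gy) pHallJ2.
have [] := Sylow_trans (sylC _ sylPy _ _) (sylC _ sylP cPP Puy).
- by rewrite /abelian centJ conjSg.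
- by rewrite memJ_conjg.
move=> c /setIP[Gc cuc] /= defP.
have Nyc: y * c \in 'N_G(P).
  by rewrite inE groupM //; apply/normP; rewrite conjsgM -defP.
have := centP (subsetP sNC _ Nyc) _ Pu => /commute_sym/commgP/conjg_fixP.
rewrite conjgM => {2}<-; apply/esym/conjg_fixP/commgP.
by apply/commute_sym/cent1P.
Qed.

(** On [P] the transfer is the power map of exponent [#|G : P|], which is injective as this index is
    prime to [p]; its kernel is the complement. *)
Lemma Burnside_normal_complement p (gT : finGroupType) (G P : {group gT}) :
    p.-Sylow(G) P -> 'N_G(P) \subset 'C(P) ->
  exists K : {group gT}, K ><| P = G.
Proof.
move=> sylP sNC; have [sPG pP p'GP] := and3P sylP.
have cPP: abelian P by rewrite /abelian (subset_trans _ sNC) // subsetI sPG normG.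
have cAA: abelian (idm P @* P) by rewrite morphim_idm.
pose V := transfer G cAA; pose Vm := transfer_morphism G cAA.
have VP g: g \in P -> V g = FiniteModule.fmod cAA (g ^+ #|G : P|).
  move=> Pg; have Ag: g \in idm P @* P by rewrite morphim_idm.
  have Gg := subsetP sPG g Pg.
  have trX := transversalP (rcosets_cycle_partition sPG Gg).
  set X := transversal _ _ in trX.
  (* Each term is a conjugate, lying in [P], of a power of [g]: fusion removes the conjugation, and
     the exponents add up to [#|G : P|]. *)
  rewrite /V (transfer_cycle_expansion sPG cAA Gg trX).
  rewrite -(sum_index_rcosets_cycle sPG Gg trX) FiniteModule.fmodX //.
  rewrite -GRing.sumrMnr; apply: eq_bigr => x Xx; rewrite -FiniteModule.fmodX //=.
  have Gx: x \in G by apply: (subsetP (transversal_sub trX)).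
  rewrite (Sylow_abelian_fusion sylP sNC) ?groupX ?groupV //.
  by rewrite conjgE invgK mulgA -mem_rcoset mulg_exp_card_rcosets.
have tiKP: 'ker Vm :&: P = 1.
  apply/trivgP/subsetP=> h /setIP[kerh Ph]; have := mker kerh.
  rewrite /= -/(V h) VP // => /(congr1 val) /=.
  rewrite FiniteModule.fmodK ?groupX /= ?morphim_idm // => /eqP hm1.
  rewrite inE -order_eq1 -dvdn1.
  have: #[h] %| gcdn #|P| #|G : P|.
    by rewrite dvdn_gcd order_dvdG // order_dvdn hm1.
  by have /eqP-> := pnat_coprime pP p'GP.
have leVP: #|Vm @* G| <= #|P|.
  rewrite -(card_imset _ val_inj) subset_leq_card //.
  apply/subsetP=> _ /imsetP[u _ ->].
  by have := FiniteModule.fmodP u; rewrite /= morphim_idm.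
have sKG: 'ker Vm \subset G := subsetIl _ _.
exists ('ker Vm)%G; rewrite sdprodE //=; last exact: subset_trans sPG (ker_norm _).
apply/eqP; rewrite eqEcard mul_subG //= TI_cardMg // -{1}(Lagrange sKG).
by rewrite leq_mul // -card_quotient ?ker_norm // (card_isog (first_isog Vm)).
Qed.

(** * Solubility criteria and coset counting *)

Lemma joing_sol (gT : finGroupType) (A B : {group gT}) :
  solvable A -> solvable B -> B \subset 'N(A) -> solvable (A <*> B).
Proof.
move=> solA solB nAB.
have nsA: A <| A <*> B by rewrite /normal joing_subl join_subG normG.
by rewrite (series_sol nsA) solA quotientYidl // quotient_sol.
Qed.

(* If A is not normal, then modulo A :&: A :^ y, which is central in G, it becomes a
   Frobenius complement, and G = PA for an A-invariant Sylow subgroup P of the kernel. *)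
Lemma maximal_abelian_sol (gT : finGroupType) (G A : {group gT}) :
  abelian A -> maximal A G -> solvable G.
Proof.
have [n] := ubnP #|G|; elim: n gT G A => // n IHn gT G A /ltnSE-leGn cAA maxA.
have [/andP[sAG not_sGA] maxAG] := maxgroupP maxA.
have defG (H : {group gT}): A \subset H -> H \subset G -> ~~ (H \subset A) -> H :=: G.
  move=> sAH sHG; apply: contraNeq => neqHG; rewrite (maxAG H) //.
  by rewrite properEneq neqHG.
have [nAG | not_nAG] := boolP (G \subset 'N(A)).
  have [y Gy notAy] := subsetPn not_sGA.
  have <-: A <*> <[y]> = G.
    apply: defG; rewrite ?joing_subl ?join_subG ?cycle_subG ?sAG //.
    by rewrite negb_and notAy orbT.
  rewrite joing_sol ?abelian_sol ?cycle_abelian //.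
  by rewrite cycle_subG (subsetP nAG).
have defN: 'N_G(A) \subset A.
  apply: contraR not_nAG => /defG <-; first exact: subsetIr.
    by rewrite subsetI sAG normG.
  exact: subsetIl.
have [tiA | ] := boolP [forall y in G :\: A, A :&: A :^ y == 1]; last first.
  rewrite negb_forall_in => /exists_inP[y /setDP[Gy notAy] ntAAy].
  set Z := A :&: A :^ y.
  have defG': A <*> A :^ y = G.
    have sAyG: A :^ y \subset G by rewrite -(conjGid Gy) conjSg.
    apply: defG; rewrite ?joing_subl ?join_subG ?sAG ?subxx //=.
    by apply: contra notAy => sAyA; rewrite (subsetP defN) // !inE Gy.
  have cGZ: G \subset 'C(Z).
    rewrite -defG' join_subG /Z; apply/andP; split; rewrite centsC.
      by rewrite subIset // [A \subset _]cAA.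
    by rewrite subIset // orbC [_ \subset 'C(A :^ y)]abelianJ cAA.
  have nZG: G \subset 'N(Z) := subset_trans cGZ (cent_sub _).
  have nsZG: Z <| G by rewrite /normal nZG !subIset ?sAG.
  have nsZA: Z <| A by apply: normalS nsZG => //; apply: subsetIl.
  rewrite (series_sol nsZG) abelian_sol ?(abelianS (subsetIl _ _)) //=.
  apply: (IHn _ _ (A / Z)%G); rewrite ?quotient_abelian ?quotient_maximal //.
  apply: leq_trans leGn; apply: ltn_quotient => //.
  exact: subset_trans (subsetIl _ _) sAG.
have [A1 | ntA] := eqVneq (gval A) 1.
  by case/negP: not_nAG; rewrite A1 norm1 subsetT.
have frobG: [Frobenius G with complement A].
  apply/andP; split; first by apply: contraNneq not_sGA => <-.
  apply/normedTI_memJ_P; split=> // [|a g /setD1P[nta Aa] Gg].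
    by rewrite setD_eq0 subG1.
  rewrite !inE conjg_eq1 nta /=; apply/idP/idP=> [Aag | Ag]; last by rewrite groupJ.
  apply: contraR nta => notAg.
  have /forall_inP/(_ g^-1)/= := tiA; rewrite inE !groupV notAg Gg => /(_ isT).
  move=> tiAg; rewrite -in_set1 -[[set 1]](eqP tiAg) inE Aa.
  by rewrite mem_conjgV.
have [K frobK] := Frobenius_kernel_exists frobG.
have [/sdprodP[_ mulKA nKA tiKA] ntK _ _ _] := Frobenius_context frobK.
have [p p_pr p_dv_K] : exists2 p, prime p & p %| #|K|.
  by exists (pdiv #|K|); rewrite ?pdiv_dvd // pdiv_prime // cardG_gt1.
have [P sylP nPA] :=
  sol_coprime_Sylow_exists p (abelian_sol cAA) nKA (Frobenius_coprime frobK).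
have sPK := pHall_sub sylP.
have <-: P <*> A = G.
  apply: defG; rewrite ?joing_subr // join_subG ?sAG ?andbT.
    by rewrite (subset_trans sPK) // -mulKA mulG_subl.
  rewrite subxx andbT; apply/negP => sPA.
  have: P :==: 1 by rewrite -subG1 -tiKA subsetI sPK.
  by rewrite trivg_card1 (card_Hall sylP) p_part_eq1 mem_primes p_pr cardG_gt0 p_dv_K.
have solP := nilpotent_sol (pgroup_nil (pHall_pgroup sylP)).
exact: joing_sol solP (abelian_sol cAA) nPA.
Qed.

Lemma two_primes_sol (gT : finGroupType) (G : {group gT}) (r q : nat) :
  {subset \pi(G) <= [:: r; q]} -> solvable G.
Proof.
move=> piG; apply: Burnside_p_a_q_b.
exact: (@uniq_leq_size _ (primes #|G|) [:: r; q] (primes_uniq _) piG).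
Qed.

(** Lagrange's theorem for a union of cosets, since solubilizers are only sets. *)
Lemma card_rcosets_mulG (gT : finGroupType) (H : {group gT}) (A : {set gT}) :
  H * A = A -> (#|rcosets H A| * #|H|)%N = #|A|.
Proof.
move=> HA; have covA: cover (rcosets H A) = A.
  rewrite cover_imset -[RHS]HA; apply/setP=> y; apply/bigcupP/mulsgP.
    by case=> a Aa; rewrite rcosetE => /rcosetP[h Hh ->]; exists h a.
  by case=> h a Hh Aa ->; exists a; rewrite // rcosetE mem_rcoset mulgK.
have /and3P[_ tiT _] := rcosets_partition (subsetT H).
have /eqP := trivIsetS (imsetS _ (subsetT A) : rcosets H A \subset _) tiT.
rewrite covA => <-; rewrite -sum_nat_const.
by apply: eq_bigr => _ /imsetP[a _ ->]; rewrite rcosetE card_rcoset.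
Qed.

Lemma card_prime_mul_sol (gT : finGroupType) (G : {group gT}) (q r : nat) :
  prime q -> prime r -> #|G| = (q * r)%N -> solvable G.
Proof.
move=> pr_q pr_r oG; apply: (@two_primes_sol _ _ q r) => s.
rewrite /= oG mem_primes => /and3P[pr_s _].
by rewrite Euclid_dvdM // !dvdn_prime2 // !inE.
Qed.

(** * Cosets and divisibility in the solubilizer *)

Section Solubilizer.

Variables (gT : finGroupType) (G : {group gT}) (x : gT).
Hypothesis Gx : x \in G.
Implicit Types (y z : gT) (Y : {group gT}).

Local Notation X := <[x]>.
Local Notation S := (solubilizer G x).

Lemma mem_solubilizer y : (y \in S) = (y \in G) && solvable (X <*> <[y]>).
Proof. by rewrite inE joing_idl joing_idr. Qed.

Lemma solubilizer_sub : S \subset G.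
Proof. by apply/subsetP=> y /setIdP[]. Qed.

Lemma sol_sub_solubilizer Y : solvable Y -> x \in Y -> Y \subset G -> Y \subset S.
Proof.
move=> solY Yx sYG; apply/subsetP=> y Yy; rewrite mem_solubilizer (subsetP sYG) //=.
by apply: solvableS solY; rewrite join_subG !cycle_subG Yx.
Qed.

(** [Y <*> <[y]>] is soluble, being an extension of [Y] by a cyclic group. *)
Lemma norm_sol_sub_solubilizer Y : solvable Y -> x \in Y -> 'N_G(Y) \subset S.
Proof.
move=> solY Yx; apply/subsetP=> y /setIP[Gy nYy]; rewrite mem_solubilizer Gy /=.
have: solvable (Y <*> <[y]>).
  by rewrite joing_sol ?cycle_subG // abelian_sol ?cycle_abelian.
by apply: solvableS; rewrite genS // setSU // cycle_subG.
Qed.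

Lemma norm_cycle_sub_solubilizer : 'N_G(X) \subset S.
Proof. by rewrite norm_sol_sub_solubilizer ?cycle_id ?abelian_sol ?cycle_abelian. Qed.

Lemma solubilizer_mul_cycle u y : u \in X -> y \in S -> u * y \in S /\ y * u \in S.
Proof.
move=> Xu; rewrite !mem_solubilizer => /andP[Gy solXy].
have Gu: u \in G by apply: subsetP Xu; rewrite cycle_subG.
have Wu := subsetP (joing_subl X <[y]>) u Xu.
have Wy: y \in X <*> <[y]> by rewrite (subsetP (joing_subr _ _)) ?cycle_id.
by split; rewrite groupM //=; apply: solvableS solXy;
  rewrite join_subG joing_subl cycle_subG groupM.
Qed.

Lemma mul_cycle_solubilizer : X * S = S.
Proof.
apply/eqP; rewrite eqEsubset mulG_subr andbT.
by apply/subsetP=> _ /mulsgP[u y Xu Sy ->]; have [] := solubilizer_mul_cycle Xu Sy.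
Qed.

Lemma order_dvd_solubilizer : #[x] %| #|S|.
Proof. by rewrite -(card_rcosets_mulG mul_cycle_solubilizer) dvdn_mull. Qed.

(* <z> acts on S by conjugation, and its fixed points form a union of cosets of <z>. *)
Lemma solubilizer_prime_dvd z : z \in 'N_G(X) -> prime #[z] -> #[z] %| #|S|.
Proof.
case/setIP=> Gz nXz pr_z.
have actsS: [acts <[z]>, on S | 'J].
  rewrite astabsJ cycle_subG inE; apply/subsetP=> _ /imsetP[y + ->].
  rewrite !mem_solubilizer => /andP[Gy solXy]; rewrite groupJ //=.
  suffices ->: X <*> <[y ^ z]> = (X <*> <[y]>) :^ z by rewrite -(isog_sol (conj_isog _ _)).
  by rewrite -genJ conjUg (normP nXz) -[<[y]> :^ z]genJ conjg_set1.
rewrite /dvdn (pgroup_fix_mod (pnat_id pr_z) actsS) afixJ -/(dvdn _ _).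
have zT: <[z]> * (S :&: 'C(<[z]>)) = S :&: 'C(<[z]>).
  apply/eqP; rewrite eqEsubset mulG_subr andbT.
  apply/subsetP=> _ /mulsgP[u y Zu /setIP[Sy cZy] ->].
  rewrite inE groupM ?andbT //; last exact: (subsetP (cycle_abelian z)).
  move: Sy; rewrite !mem_solubilizer => /andP[Gy solXy].
  rewrite groupM //=; last by apply: subsetP Zu; rewrite cycle_subG.
  (* As [z] normalises [X] and commutes with the fixed point [y], it normalises [X <*> <[y]>]. *)
  have: solvable ((X <*> <[y]>) <*> <[z]>).
    apply: joing_sol => //; first by rewrite abelian_sol ?cycle_abelian.
    rewrite normsY ?cycle_subG // -cycle_subG cents_norm // centsC.
    by rewrite cycle_subG.
  apply: solvableS; rewrite join_subG (subset_trans (joing_subl X <[y]>)) ?joing_subl //=.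
  rewrite cycle_subG groupM //; first exact: (subsetP (joing_subr _ <[z]>)).
  by rewrite (subsetP (joing_subl _ _)) // (subsetP (joing_subr _ _)) ?cycle_id.
by rewrite -(card_rcosets_mulG zT) dvdn_mull.
Qed.

(* Counts the right cosets of X in Sol(x) fixed by X. *)
Lemma solubilizer_norm_mod : prime #[x] ->
  #|S| %/ #[x] = #|'N_G(X)| %/ #[x] %[mod #[x]].
Proof.
move=> pr_x.
have NX: X * 'N_G(X) = 'N_G(X) by rewrite mulSGid // subsetI cycle_subG Gx normG.
rewrite -(card_rcosets_mulG mul_cycle_solubilizer) -(card_rcosets_mulG NX) !mulnK //.
have actsS: [acts X, on rcosets X S | 'Rs].
  apply/subsetP=> u Xu; rewrite !inE /=; apply/subsetP=> _ /imsetP[y Sy ->].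
  rewrite inE /= !rcosetE -rcosetM -rcosetE imset_f //.
  by have [] := solubilizer_mul_cycle Xu Sy.
rewrite (pgroup_fix_mod (pnat_id pr_x) actsS); congr (_ %% _)%N; apply: eq_card => A.
apply/setIP/imsetP=> [[/imsetP[y Sy ->]] | [y Ny ->]].
  rewrite rcosetE sub_afixRs_norm => nXy; exists y; rewrite ?rcosetE //.
  by rewrite inE nXy (subsetP solubilizer_sub).
rewrite imset_f ?(subsetP norm_cycle_sub_solubilizer) // rcosetE sub_afixRs_norm.
by case/setIP: Ny.
Qed.

End Solubilizer.

(** * Relations that force two elements to generate a soluble group *)

(** The relation writes [y ^ (x ^+ 2)] in terms of [y] and [y ^ x], so [x] normalises the abelian
    subgroup which these generate. *)
Lemma commuting_conjugates_sol (gT : finGroupType) (x y : gT) :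
  commute y (y ^ x) -> y * y ^ x * y ^ (x ^+ 2) = 1 -> solvable (<[x]> <*> <[y]>).
Proof.
move=> cyyx y3; pose M := (<[y]> <*> <[y ^ x]>)%G.
have cMM: abelian M.
  rewrite abelianY !cycle_abelian /= cent_cycle cycle_subG; exact/cent1P.
have [My Myx]: y \in M /\ y ^ x \in M.
  by rewrite -!cycle_subG joing_subl joing_subr.
have nMx: <[x]> \subset 'N(M).
  rewrite cycle_subG inE -genJ conjUg -![<[_]> :^ x]genJ !conjg_set1.
  rewrite gen_subG subUset !gen_subG !sub1set Myx /=.
  suffices ->: (y ^ x) ^ x = (y * y ^ x)^-1 by rewrite groupV groupM.
  by apply: (mulgI (y * y ^ x)); rewrite mulgV -conjgM.
have: solvable (M <*> <[x]>).
  by rewrite joing_sol ?abelian_sol ?cycle_abelian.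
apply: solvableS; rewrite join_subG joing_subr /=.
by rewrite (subset_trans _ (joing_subl _ _)) ?cycle_subG.
Qed.

(* u v^-1 and its conjugates under u generate an abelian normal subgroup. *)
Lemma triangle333_sol (gT : finGroupType) (u v : gT) :
  u ^+ 3 = 1 -> v ^+ 3 = 1 -> (u * v) ^+ 3 = 1 -> solvable (<[u]> <*> <[v]>).
Proof.
move=> u3 v3 uv3; pose y := u * v^-1.
have uu: u * u = u^-1 by apply: (mulgI u); rewrite mulgV -[RHS]u3 !expgS expg0 mulg1.
have vv: v^-1 * v^-1 = v.
  by apply: (mulIg v^-1); rewrite mulgV -[RHS]invg1 -v3 !expgS expg0 mulg1 !invMg.
(* This is the relation on [u * v]; it will make [y ^ u * y] equal to [y * y ^ u], both being
   [u * v * u]. *)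
have uvu: u * v * u = v^-1 * u^-1 * v^-1.
  apply: (mulIg (v * u * v)); rewrite -[LHS]/(u * v * u * (v * u * v)).
  rewrite -!mulgA [RHS]mulgA.
  have := uv3; rewrite !expgS expg0 mulg1 -!mulgA => ->.
  by rewrite !mulgA mulgKV mulgKV mulVg.
have yu: y ^ u = v^-1 * u by rewrite /y conjgE !mulgA mulVg mul1g.
have yyu: y * y ^ u = u * v * u by rewrite yu /y !mulgA -(mulgA u) vv.
have yuy: y ^ u * y = u * v * u.
  by rewrite yu /y uvu !mulgA -(mulgA v^-1 u u) uu.
have yuu: y ^ (u ^+ 2) = (u * v * u)^-1.
  rewrite [_ ^+ 2]/(u * u) conjgM yu conjgE !invMg !mulgA.
  by rewrite -(mulgA _ u u) uu.
have := commuting_conjugates_sol (x := u) (y := y).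
rewrite /commute yyu yuy yuu mulgV => /(_ erefl erefl).
apply: solvableS; rewrite join_subG joing_subl cycle_subG.
have ->: v = y^-1 * u by rewrite /y invMg invgK mulgKV.
have [Wu Wy]: u \in <[u]> <*> <[y]> /\ y \in <[u]> <*> <[y]>.
  by rewrite -!cycle_subG joing_subl joing_subr.
by rewrite groupM ?groupV.
Qed.

(* y has the form k^-1 k^x, so that the product telescopes. *)
Lemma regular_order3_norm (gT : finGroupType) (K : {group gT}) (x y : gT) :
    x \in 'N(K) -> 'C_K[x] = 1 -> x ^+ 3 = 1 -> y \in K ->
  y * y ^ x * y ^ (x ^+ 2) = 1.
Proof.
move=> nKx regKx x3 Ky.
(* Two elements with the same commutator differ by an element of ['C_K[x]]; injectivity on the
   finite set [K] then gives surjectivity. *)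
have inj: {in K &, injective (fun k => [~ k, x])}.
  move=> k l Kk Kl /= eqkl; apply/esym/eqP; rewrite eq_mulgV1 -in_set1 -[[set 1]]regKx.
  rewrite inE groupM ?groupV //; apply/cent1P/commgP/conjg_fixP.
  rewrite conjMg conjVg; apply: (mulgI l^-1); rewrite mulgA -commgEl -eqkl.
  by rewrite commgEl mulgK mulKg.
have /imsetP[k Kk ->]: y \in [set [~ k, x] | k in K].
  suffices ->: [set [~ k, x] | k in K] = K by [].
  apply/eqP; rewrite eqEcard card_in_imset // leqnn andbT.
  apply/subsetP=> _ /imsetP[k Kk ->]; rewrite commgEl groupM ?groupV //.
  by rewrite memJ_norm.
have kJ z : (k^-1 * k ^ x) ^ z = (k ^ z)^-1 * k ^ (x * z).
  by rewrite (conjMg k^-1 (k ^ x)) conjVg conjgM.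
rewrite /= commgEl !kJ -[x * x ^+ 2]expgS x3 conjg1 -[x ^+ 2]/(x * x).
by move: (k ^ x) (k ^ (x * x)) => b c; rewrite !mulgA !mulgK mulVg.
Qed.

(** * Characters at an element of order 3 conjugate to its inverse *)

Section OrderThree.

Import Order.TTheory GRing.Theory Num.Theory.

(** Meant for the values [a] at [x] and the degrees [d] of the irreducible characters, [i0] being
    the trivial one. Exactly three [a i] are nonzero, each 1 or -1, and the linear relation leaves
    the sum 1 + 1/f - 1/(f + 1). *)
Lemma three_unit_sum (I : finType) (i0 : I) (a d : I -> algC) :
    (forall i, a i \in Num.int) -> (forall i, 1 <= d i)%R -> a i0 = 1%R -> d i0 = 1%R ->
    (\sum_i a i ^+ 2 = 3%:R)%R -> (\sum_i a i * d i = 0)%R ->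
  (1 < \sum_i a i ^+ 3 / d i)%R.
Proof.
move=> Za d_ge1 a0 d0 a2 ad; set F := BIG_F.
pose b i := Num.truncn `|a i|%R; pose D := [set i | a i != 0%R].
have bE i : ((b i)%:R = `|a i|)%R by rewrite truncnK // natr_norm_int.
have b2: (\sum_i b i ^ 2 = 3)%N.
  apply/eqP; rewrite -(eqr_nat algC) natr_sum -a2; apply/eqP/eq_bigr => i _.
  by rewrite natrX bE real_normK // Rreal_int.
have b_le1 i : b i <= 1.
  rewrite -ltnS -(@ltn_exp2r _ _ 2) //.
  by rewrite -[(2 ^ 2)%N]/(3.+1) ltnS -b2 (bigD1 i) //= leq_addr.
have bD i : b i = (i \in D).
  have: (i \in D) = (b i != 0)%N by rewrite inE -(eqr_nat algC) bE normr_eq0.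
  by case: (b i) (b_le1 i) => [|[|]] // _ ->.
have aD i : i \in D -> (a i = 1 \/ a i = -1)%R.
  move=> Di; have/eqP := bE i; rewrite bD Di => /eqP a1.
  have: (a i ^+ 2 == 1)%R by rewrite -real_normK ?Rreal_int // -a1 expr1n.
  by rewrite sqrf_eq1 => /orP[]/eqP->; [left | right].
have cardD: #|D| = 3.
  rewrite -b2 -sum1_card big_mkcond /=; apply: eq_bigr => i _.
  by rewrite bD; case: ifP.
have D0: i0 \in D by rewrite inE a0 oner_eq0.
have /eqP/cards2P[i [j [neq_ij defD]]]: #|D :\ i0| = 2.
  by move: (cardsD1 i0 D); rewrite D0 cardD add1n => -[].
have [Di Dj]: i \in D /\ j \in D.
  by split; apply: (subsetP (subsetDl D [set i0])); rewrite defD !inE eqxx ?orbT.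
have sumD (f : I -> algC) : (forall i, a i = 0 -> f i = 0)%R ->
    (\sum_i f i = f i0 + (f i + f j))%R.
  move=> f0; rewrite (bigID [in D]) /= addrC big1 ?add0r => [|k]; last first.
    by rewrite inE negbK => /eqP/f0.
  by rewrite (big_setD1 i0) //= defD big_setU1 ?inE //= big_set1.
move: ad; rewrite !sumD {}/F => [|k -> |k ->]; rewrite ?expr0n ?mul0r //.
have a3 k : k \in D -> (a k ^+ 3 = a k)%R.
  by case/aD=> ->; rewrite ?expr1n // -signr_odd expr1.
rewrite !a3 // a0 d0 invr1 !mulr1.
have d_gt0 k: (0 < d k)%R by apply: lt_le_trans (d_ge1 k).
have pair_case k l : (1 + (d k - d l) = 0 -> 1 < 1 + (1 / d k - 1 / d l))%R.
  move=> dkl; rewrite ltrDl subr_gt0 !mul1r ltf_pV2 ?posrE ?d_gt0 //.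
  by move/eqP: dkl; rewrite addrA subr_eq0 => /eqP <-; rewrite ltrDr.
case: (aD i Di) (aD j Dj) => -> [] ->; rewrite ?mul1r ?mulN1r.
- by move=> /eqP; rewrite gt_eqF // !addr_gt0.
- by move/pair_case; rewrite !mul1r.
- by rewrite ![(- _ + _)%R]addrC => /pair_case; rewrite !mul1r.
(* Two values -1 would give [d i + d j = 1], with both terms at least 1. *)
move=> /eqP; rewrite -opprD subr_eq0 => /eqP d1.
have := lerD (d_ge1 i) (d_ge1 j); rewrite -d1 -[X in (_ <= X)%R]addr0.
by rewrite lerD2l ler10.
Qed.

Variables (gT : finGroupType) (G : {group gT}) (x : gT).
Hypotheses (Gx : x \in G) (ox : #[x] = 3) (xVG : x^-1 \in x ^: G).

(** The trivial character has multiplicity (chi(1) + 2 chi(x)) / 3 in the restriction to [<[x]>], so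
    the algebraic integer chi(x) is rational. *)
Lemma char_order3_int (chi : 'CF(G)) : chi \is a character -> chi x \in Num.int.
Proof.
move=> Nchi; have sXG: <[x]> \subset G by rewrite cycle_subG.
have chiV: chi x^-1 = chi x by case/imsetP: xVG => z Gz ->; rewrite cfunJ.
have nt_x: x != 1 by rewrite -order_eq1 ox.
have neqV: x^-1 != x.
  by rewrite eq_invg_mul -[x * x]/(x ^+ 2) -order_dvdn ox.
have notx: x \notin [set 1] by rewrite inE.
have notV: x^-1 \notin x |: [set 1] by rewrite !inE invg_eq1 negb_or neqV.
have defX: <[x]> = x^-1 |: (x |: [set 1]).
  apply/eqP; rewrite eq_sym eqEcard !subUset !sub1set group1 groupV cycle_id /=.
  by rewrite -orderE ox !cardsU1 cards1 notx notV.
have := Cnat_cfdot_char (cfRes_char <[x]> Nchi) (cfun1_char <[x]>).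
rewrite cfdotE -orderE ox (eq_bigl [in x^-1 |: (x |: [set 1])]) => [|u]; last by rewrite -defX.
rewrite !big_setU1 //= big_set1 !cfun1E groupV cycle_id group1 conjC1 !mulr1.
rewrite !cfResE ?groupV ?cycle_id ?group1 // chiV => /natrP[n En].
rewrite Cint_rat_Aint ?Aint_char //.
have -> : (chi x = (3 * n%:R - chi 1%g) / 2)%R.
  rewrite -En mulVKf ?pnatr_eq0 // addrA addrK -mulr2n.
  by rewrite -[(chi x *+ 2)%R]mulr_natr mulfK ?pnatr_eq0.
have /natrP[m ->] := Cnat_char1 Nchi.
by rewrite rpred_div ?rpredB ?rpredM ?rpred_nat.
Qed.

(* Since |C_G(x)| = 3, only the trivial character and two others do not vanish at
   x; the latter take the values 1 and -1 there and have degrees f and f + 1. *)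
Lemma order3_class_bound :
    #|'C_G[x]| = 3 ->
    {in x ^: G &, forall u v, u * v = x -> u = x^-1} ->
  #|G| < 9.
Proof.
move=> oC uniq_uv; pose k := enum_rank_in (classes1 G) (x ^: G).
have enum_k: enum_val k = x ^: G by rewrite enum_rankK_in ?mem_classes.
have Kx: x \in enum_val k by rewrite enum_k class_refl.
have xx: x * x = x^-1 by apply: (mulgI x); rewrite mulgV -[RHS](expg_order x) ox.
have := @gring_classM_coef_sum_eq _ _ k k k x x x Kx Kx Kx.
rewrite (set_gring_classM_coef _ _ Kx) enum_k.
have ->: gring_classM_coef_set (x ^: G) (x ^: G) x = [set (x^-1, x^-1)].
  apply/setP=> [[u v]]; rewrite !inE /=; apply/idP/eqP=> [|[-> ->]].
    case/andP=> /andP[Ku Kv] /eqP uvx; have uV := uniq_uv u v Ku Kv uvx.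
    by congr (_, _) => //; rewrite -(mulKg u v) uvx uV invgK xx.
  by rewrite xVG -invMg xx invgK eqxx.
have int_x i := char_order3_int (irr_char i).
have chi0 : ('chi[G]_0 =1 (fun y => (y \in G)%:R))%R.
  by move=> y; rewrite irr0 cfun1E.
have sum_gt1 : (1 < \sum_i 'chi[G]_i x ^+ 3 / 'chi_i 1%g)%R.
  apply: (three_unit_sum (i0 := 0%R)) => [i|i||||] //.
  - have /natrP[[|n] En] := Cnat_char1 (irr_char i).
      by have:= irr1_gt0 i; rewrite En ltxx.
    by rewrite En ler1n.
  - by rewrite chi0 Gx.
  - by rewrite chi0 group1.
  - have := second_orthogonality_relation x Gx.
    rewrite class_refl oC mulr1n => <-.
    by apply: eq_bigr => i _; rewrite (CrealP (Rreal_int (int_x i))).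
  have := second_orthogonality_relation x (group1 G).
  rewrite class1G inE -order_eq1 ox => /= sum0; rewrite -[RHS]sum0.
  by apply: eq_bigr => i _; rewrite (CrealP (Rreal_nat (Cnat_char1 (irr_char i)))).
set c := #|x ^: G|; have oG: #|G| = (3 * c)%N.
  by rewrite /c -index_cent1 -oC Lagrange ?subsetIl.
have c_gt0: 0 < c by rewrite /c -index_cent1 indexg_gt0.
have c_neq0: (c%:R != 0 :> algC)%R by rewrite pnatr_eq0 -lt0n.
(* The class algebra formula now reads 1 = (c / 3) s with s > 1, so c < 3. *)
rewrite /= cards1 oG !natrM invfM [(3%:R^-1 * _)%R]mulrC mulrA mulfK // => sum_c.
rewrite -[9]/(3 * 3)%N ltn_pmul2l // -(ltr_nat algC).
rewrite -[X in (_ < X)%R]mulr1 -[X in (_ * X)%R]/(1%:R)%R sum_c mulrCA mulrA.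
rewrite divfK ?pnatr_eq0 // -[X in (X < _)%R]mulr1 ltr_pM2l ?ltr0n //.
apply: lt_le_trans sum_gt1 _; rewrite le_eqVlt; apply/orP; left; apply/eqP.
apply: eq_bigr => i _; rewrite (CrealP (Rreal_int (int_x i))).
by rewrite exprSr expr2.
Qed.

End OrderThree.

(** * Case analysis on the order of [x] *)

Section Cases.

Variables (gT : finGroupType) (G : {group gT}) (x : gT).
Hypothesis Gx : x \in G.

Local Notation X := <[x]>.
Local Notation S := (solubilizer G x).
Local Notation N := 'N_G(<[x]>).

(* The x-invariant Sylow subgroups Q of the normal complement satisfy QX <= S. *)
Lemma Burnside_solubilizer_sol p q r (P : {group gT}) :
    p.-Sylow(G) P -> 'N_G(P) \subset 'C(P) -> x \in P ->
    (forall Q : {group gT}, coprime #|Q| #[x] -> Q * X \subset S ->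
      {subset \pi(Q) <= [:: q; r]}) ->
  solvable G.
Proof.
move=> sylP sNC Px piQ; have [sPG pP _] := and3P sylP.
have cPP: abelian P by rewrite /abelian (subset_trans _ sNC) // subsetI sPG normG.
have [K defG] := Burnside_normal_complement sylP sNC.
have [nsKG _ mulKP nKP tiKP] := sdprod_context defG.
have sXP: X \subset P by rewrite cycle_subG.
have p'K := pHall_pgroup (introT (sdprod_normal_pHallP nsKG sylP) defG).
have coKX: coprime #|K| #|X| by rewrite coprime_sym (pnat_coprime (pgroupS sXP pP)).
suffices solK: solvable K.
  rewrite (series_sol nsKG) solK -mulKP quotientMidl.
  by rewrite quotient_sol ?abelian_sol.
apply: two_primes_sol (q) (r) _ => s piKs.
have [Q sylQ nQX] := sol_coprime_Sylow_exists s (abelian_sol (cycle_abelian x))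
  (subset_trans sXP nKP) coKX.
have [sQK sQ _] := and3P sylQ.
apply: (piQ Q); first by rewrite (coprimeSg sQK).
  rewrite -norm_joinEr //; apply: sol_sub_solubilizer.
  - by rewrite joing_sol ?(abelian_sol (cycle_abelian x)) ?(nilpotent_sol (pgroup_nil sQ)).
  - by rewrite (subsetP (joing_subr _ _)) ?cycle_id.
  by rewrite join_subG cycle_subG Gx (subset_trans sQK (normal_sub nsKG)).
by rewrite /= (card_Hall sylQ) pi_of_part // !inE /= piKs /= eqxx.
Qed.

(** Here [#|Q| * #[x] <= #|S|] gives [#|Q| <= 3], which leaves the primes 2 and 3. *)
Lemma bounded_Sylow_sol p (P : {group gT}) :
    p.-Sylow(G) P -> 'N_G(P) \subset 'C(P) -> x \in P -> #|S| <= 3 * #[x] ->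
  solvable G.
Proof.
move=> sylP sNC Px leS.
apply: (Burnside_solubilizer_sol (q := 2) (r := 3) sylP sNC Px) => Q coQX sQXS s.
rewrite mem_primes => /and3P[pr_s _ /dvdn_leq-/(_ (cardG_gt0 _)) le_sQ].
have: #|Q| * #[x] <= 3 * #[x].
  by rewrite -coprime_cardMg ?(leq_trans (subset_leq_card sQXS)).
rewrite leq_pmul2r // => /(leq_trans le_sQ).
by case: s pr_s {le_sQ} => [|[|[|[|]]]].
Qed.

(** [x] and its inverse act without fixed points on the normal complement [K], so the product of
    [y], [y ^ x] and [y ^ (x ^+ 2)] is 1 with the last two in either order, and [y] commutes with
    [y ^ x]. *)
Lemma regular_order3_solubilizer :
  3.-Sylow(G) X -> #[x] = 3 -> 'N_G(X) = X -> S = G.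
Proof.
move=> sylX ox NX; apply/eqP; rewrite eqEsubset solubilizer_sub /=.
have sNC: 'N_G(X) \subset 'C(X) by rewrite NX; apply: cycle_abelian.
have [K defG] := Burnside_normal_complement sylX sNC.
have [nsKG _ mulKX nKX tiKX] := sdprod_context defG.
have nKx: x \in 'N(K) by rewrite -cycle_subG.
have regKx z : <[z]> = X -> 'C_K[z] = 1.
  move=> defX; have sCX: 'C_K[z] \subset X.
    rewrite -NX subsetI subIset ?(normal_sub nsKG) // cents_norm //.
    by rewrite -defX cent_cycle subsetIr.
  by apply/trivgP; rewrite -tiKX subsetI subsetIl.
(* Since [G] is [X * K] and [S] absorbs [X], it is enough to place [K] in [S]. *)
rewrite -{1}mulKX -(normC nKX) -(mul_cycle_solubilizer Gx) mulgS //.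
apply/subsetP=> y Ky; rewrite mem_solubilizer (subsetP (normal_sub nsKG)) //=.
have x3: x ^+ 3 = 1 by rewrite -ox expg_order.
have y1 := regular_order3_norm nKx (regKx x erefl) x3 Ky.
have y2 : y * y ^ (x ^+ 2) * y ^ x = 1.
  have x2V: x ^+ 2 = x^-1 by apply: (mulgI x); rewrite mulgV -x3.
  have := @regular_order3_norm _ K x^-1 y; rewrite groupV expgVn x3 invg1.
  by rewrite regKx ?cycleV // expgVn x2V invgK; apply.
apply: commuting_conjugates_sol => //.
move: (y ^ x) (y ^ (x ^+ 2)) y1 y2 => a b y1 y2.
by apply: (mulIg b); rewrite y1 -mulgA -[y * b](mulgK a) y2 mul1g mulgV.
Qed.

Lemma cycle_sub_norm : X \subset N.
Proof. by rewrite subsetI cycle_subG Gx normG. Qed.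

(** [N / 'C_N(X)] embeds in the automorphism group of the cyclic group [X]. *)
Lemma index_cent_norm_cycle : #|N : 'C_N(X)| %| totient #[x].
Proof.
have := cardSg (Aut_conj_aut <[x]>%G N).
by rewrite card_Aut_cycle card_morphim ker_conj_aut (setIidPr (subsetIr _ _)) indexgI.
Qed.

Lemma index_cent_norm_neq1 : (#|N : 'C_N(X)| != 1)%N = ~~ (N \subset 'C(X)).
Proof. by rewrite indexg_eq1 subsetI subxx. Qed.

(** If [X] were proper in a Sylow subgroup [P], then ['N_P(X)] would be larger than [X], so of order
    divisible by [p ^ 2]. *)
Lemma cycle_Sylow p : prime p -> #[x] = p -> ~~ (p ^ 2 %| #|N|) -> p.-Sylow(G) X.
Proof.
move=> pr_p ox; apply: contraR => not_sylX.
have sXG: X \subset G by rewrite cycle_subG.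
have pX: p.-group X by rewrite /pgroup -orderE ox pnat_id.
have [P sylP sXP] := Sylow_superset sXG pX; have [sPG pP _] := and3P sylP.
have ltXP: X \proper P.
  rewrite properEneq sXP andbT; apply: contraNneq not_sylX => ->; exact: sylP.
have := nilpotent_proper_norm (pgroup_nil pP) ltXP.
set M := 'N_P(X) => ltXM; have sMN: M \subset N by rewrite setSI.
apply: dvdn_trans (cardSg sMN).
have [k oM] := p_natP (pgroupS (subsetIl P _ : M \subset P) pP : p.-nat #|M|).
rewrite oM dvdn_exp2l // ltnNge; apply: contraL (proper_card ltXM) => le_k1.
by rewrite -orderE ox oM -leqNgt -{2}(expn1 p) leq_pexp2l // prime_gt0.
Qed.

(** In an insoluble [H] minimal subject to containing [x], any proper subgroup through [x] is
    soluble, hence inside [S = X]. *)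
Lemma solubilizer_cycle_sol : S = X -> solvable G.
Proof.
move=> SX; apply: contraT => not_solG.
pose bad := [pred H : {group gT} | (x \in H) && ~~ solvable H].
have badG: bad G by rewrite /= Gx.
have [H /mingroupP[/andP[Hx not_solH] minH] sHG] := @mingroup_exists _ bad _ badG.
have solX: solvable X by rewrite abelian_sol ?cycle_abelian.
case/negP: (not_solH); apply: maximal_abelian_sol (cycle_abelian x) _.
apply/maxgroupP; split=> [|M ltMH sXM].
  rewrite properEneq cycle_subG Hx andbT.
  by apply: contraNneq not_solH => <-.
have [sMH not_sHM] := andP ltMH.
apply/eqP; rewrite eq_sym eqEsubset sXM /= -SX sol_sub_solubilizer //.
- apply: contraR not_sHM => not_solM; rewrite -(minH M) //.
  by rewrite /= not_solM -cycle_subG sXM.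
- by rewrite -cycle_subG.
exact: subset_trans sMH sHG.
Qed.

(** If conjugates [u], [v] of [x] have product [x], the triangle relations put [u] in [S = N], whose
    only elements of order 3 are [x] and its inverse; [u = x] would force [v = 1]. *)
Lemma order3_norm6_sol :
  #[x] = 3 -> S = N -> #|S| = 6 -> #|'C_N(X)| = 3 -> solvable G.
Proof.
move=> ox SN oS oC; have oN: #|N| = 6 by rewrite -SN.
have CX: 'C_G[x] = 'C_N(X).
  have sCN: 'C[x] \subset 'N(X) by rewrite -cent_cycle cent_sub.
  by rewrite cent_cycle -setIA (setIidPr sCN).
have x3: x ^+ 3 = 1 by rewrite -ox expg_order.
have x2V: x ^+ 2 = x^-1 by apply: (mulgI x); rewrite mulgV -x3.
have nsXN: X <| N by rewrite /normal cycle_sub_norm subsetIr.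
have sylX: 3.-Sylow(N) X.
  by rewrite pHallE (normal_sub nsXN) oN -orderE ox p_part.
have memX y: y \in X -> #[y] = 3 -> y != x -> y = x^-1.
  move=> /cyclePmin[[|[|[|i]]]]; rewrite ox // => _ ->; rewrite ?order1 ?eqxx //.
have xVG: x^-1 \in x ^: G.
  have /subsetPn[t Nt not_ct]: ~~ (N \subset 'C(X)).
    apply/negP=> cNX; move: oC; rewrite (setIidPl cNX) oN //.
  have [Gt nXt] := setIP Nt.
  rewrite -(memX (x ^ t)) ?memJ_class ?orderJ ?memJ_norm ?cycle_id //.
  apply: contra not_ct => /eqP/conjg_fixP/commgP/cent1P.
  by rewrite cent_cycle cent1C.
have ltG9: #|G| < 9.
  apply: (order3_class_bound Gx ox xVG) => [|u v Ku Kv uvx]; first by rewrite CX.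
  have [ou ov]: #[u] = 3 /\ #[v] = 3.
    by case/imsetP: Ku => y _ ->; case/imsetP: Kv => z _ ->; rewrite !orderJ.
  have u3: u ^+ 3 = 1 by rewrite -ou expg_order.
  have v3: v ^+ 3 = 1 by rewrite -ov expg_order.
  have Nu: u \in N.
    rewrite -SN mem_solubilizer // (subsetP (class_subG Gx (subxx G))) //=.
    have := triangle333_sol u3 v3; rewrite uvx => /(_ x3); apply: solvableS.
    rewrite join_subG joing_subl cycle_subG -uvx groupM //.
      by rewrite (subsetP (joing_subl _ _)) ?cycle_id.
    by rewrite (subsetP (joing_subr _ _)) ?cycle_id.
  apply: memX => //.
    by rewrite (mem_normal_Hall sylX nsXN) // /p_elt ou.
  apply/eqP=> ux; move: uvx ov; rewrite ux -[RHS](mulg1 x) => /mulgI->.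
  by rewrite order1.
have dvG: 6 %| #|G| by rewrite -oN cardSg ?subsetIl.
have oG: #|G| = 6.
  by case/dvdnP: dvG ltG9 (cardG_gt0 G) => [[|[|k]]] ->.
exact: (@card_prime_mul_sol _ _ 2 3).
Qed.

Lemma solubilizer_order_p p :
    ~~ solvable G -> prime p -> #[x] = p -> #|S| = (3 * p)%N ->
  p = 1 %[mod 3] /\ S = N.
Proof.
move=> insolG pr_p ox oS; have p_gt0 := prime_gt0 pr_p.
have sNS := norm_cycle_sub_solubilizer G x.
have noB (P : {group gT}) : p.-Sylow(G) P -> x \in P -> ~~ ('N_G(P) \subset 'C(P)).
  move=> sylP Px; apply: contra insolG => sNC.
  by apply: (bounded_Sylow_sol sylP sNC Px); rewrite oS ox.
have [k oN] : exists k, #|N| = (k * p)%N.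
  by apply/dvdnP; rewrite -ox orderE cardSg ?cycle_sub_norm.
have k_gt0: 0 < k by have := cardG_gt0 N; rewrite oN muln_gt0 => /andP[].
have k_le3: k <= 3 by rewrite -(leq_pmul2r p_gt0) -oN -oS subset_leq_card.
(* With [k] equal to [#|N| / p], the coset count says that [k] is 3 modulo [p]. *)
have := solubilizer_norm_mod Gx; rewrite ox oS oN !mulnK // => /(_ pr_p) kp.
have p_dv: p %| 3 - k by rewrite -eqn_mod_dvd // kp.
have k_neq2: k != 2.
  by apply: contraTneq p_dv => ->; rewrite dvdn1 neq_ltn prime_gt1 ?orbT.
have SN_k3: k = 3 -> S = N.
  by move=> k3; apply/eqP; rewrite eq_sym eqEcard sNS oS oN k3 /=.
(* If [p] is 3, then [N] has order 9 and equals [S]; a Sylow subgroup [P] above it is soluble, so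
   lies in [S]. Thus [P = N] is abelian and self-normalising, against [noB]. *)
have [p3 | p_neq3] := eqVneq p 3.
  have k3: k = 3.
    by move: p_dv k_gt0 k_le3; rewrite p3; case: (k) => [|[|[|[|]]]].
  have oN9: #|N| = (3 ^ 2)%N by rewrite oN k3 p3.
  have pN: p.-group N by rewrite /pgroup oN9 p3.
  have Nx: x \in N by rewrite (subsetP cycle_sub_norm) ?cycle_id.
  have [P sylP sNP] := Sylow_superset (subsetIl G 'N(X)) pN.
  have [sPG pP _] := and3P sylP.
  have sPN: P \subset N.
    have solP := nilpotent_sol (pgroup_nil pP).
    by rewrite -(SN_k3 k3) sol_sub_solubilizer // (subsetP sNP).
  have PN: P :=: N by apply/eqP; rewrite eqEsubset sPN.
  have /negP[] := noB P sylP (subsetP sNP x Nx).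
  have cPP: abelian P by rewrite PN (@card_p2group_abelian _ 3) //.
  have := norm_sol_sub_solubilizer G (abelian_sol cPP) (subsetP sNP x Nx).
  by rewrite (SN_k3 k3) -PN => /subset_trans; apply.
have sylX: p.-Sylow(G) X.
  apply: cycle_Sylow => //; rewrite oN expnS expn1 dvdn_pmul2r //.
  move: k_gt0 k_le3 k_neq2; case: (k) => [|[|[|[|]]]] // _ _ _.
    by rewrite dvdn1 neq_ltn prime_gt1 ?orbT.
  by rewrite dvdn_prime2.
have notCN: ~~ (N \subset 'C(X)) := noB _ sylX (cycle_id x).
have k3: k = 3.
  have: k != 1%N.
    apply: contraNneq notCN => k1; rewrite (_ : N = X) ?[_ \subset _]cycle_abelian //.
    by apply/eqP; rewrite eq_sym eqEcard cycle_sub_norm oN k1 mul1n -orderE ox /=.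
  by move: k_gt0 k_le3 k_neq2; case: (k) => [|[|[|[|]]]].
split; last exact: SN_k3.
(* [X] is abelian, so the index divides [#|N : X|], which is 3. *)
have i_dv3: #|N : 'C_N(X)| %| 3.
  have sXC: X \subset 'C_N(X) by rewrite subsetI cycle_sub_norm; apply: cycle_abelian.
  rewrite -(dvdn_pmul2r p_gt0) -k3 -oN -(Lagrange (subsetIl N 'C(X))) mulnC.
  by rewrite dvdn_pmul2r ?indexg_gt0 // -ox orderE cardSg.
have i3: #|N : 'C_N(X)| = 3.
  by apply/prime_nt_dvdP; rewrite ?index_cent_norm_neq1.
have := index_cent_norm_cycle; rewrite i3 ox totient_prime // => dv3.
by apply/eqP; rewrite eqn_mod_dvd ?subn1.
Qed.

Lemma solubilizer_order3 p :
    prime p -> #[x] = 3 -> #|S| = (3 * p)%N -> p != 3 -> solvable G.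
Proof.
move=> pr_p ox oS p_neq3; have sNS := norm_cycle_sub_solubilizer G x.
have pr_x: prime #[x] by rewrite ox.
have oX: #|X| = 3 by rewrite -orderE.
have [j oN] : exists j, #|N| = (j * 3)%N.
  by apply/dvdnP; rewrite -oX cardSg ?cycle_sub_norm.
(* By the coset count [#|N| / 3] is congruent to [p] modulo 3, hence not divisible by 3. *)
have not9: ~~ (3 ^ 2 %| #|N|).
  rewrite oN expnS expn1 dvdn_pmul2r //.
  have := solubilizer_norm_mod Gx pr_x.
  rewrite ox oS oN mulKn // mulnK // /dvdn => <-; rewrite -/(dvdn 3 p).
  by rewrite dvdn_prime2 // eq_sym.
have sylX: 3.-Sylow(G) X := cycle_Sylow (isT : prime 3) ox not9.
have primeN s : prime s -> s %| #|N| -> s != 3 -> s = p.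
  move=> pr_s /Cauchy[] // z Nz oz s_neq3.
  have := solubilizer_prime_dvd Nz; rewrite oz oS Euclid_dvdM // => /(_ pr_s).
  by rewrite !dvdn_prime2 // (negPf s_neq3) => /eqP.
have SN_p: p %| #|N| -> S = N.
  move=> p_dv; apply/eqP; rewrite eq_sym eqEcard sNS oS dvdn_leq // Gauss_dvd.
    by rewrite p_dv oN dvdn_mull.
  by rewrite prime_coprime // dvdn_prime2 // eq_sym.
have [sNC | not_sNC] := boolP (N \subset 'C(X)).
  have [NX | ntN] := eqVneq #|N : X| 1%N.
    have {}NX: N = X.
      by apply/eqP; rewrite eqEsubset cycle_sub_norm -indexg_eq1 NX eqxx.
    (* When [N = X], the group [G] equals [S] and has order [3 * p]. *)
    apply: (card_prime_mul_sol (isT : prime 3) pr_p).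
    by rewrite -oS regular_order3_solubilizer.
  have /pdivP[s pr_s s_dv] : 1 < #|N : X| by rewrite ltn_neqAle eq_sym ntN indexg_gt0.
  have oNX: #|N| = (#|N : X| * 3)%N by rewrite -oX mulnC Lagrange ?cycle_sub_norm.
  have s_p: s = p.
    apply: primeN => //; first by rewrite oNX dvdn_mulr.
    by apply: contraNneq not9 => s3; rewrite oNX expnS expn1 dvdn_pmul2r // -s3.
  have SN: S = N by apply: SN_p; rewrite oNX dvdn_mulr // -s_p.
  (* Any such [Q] lies in [S = N] and has order prime to 3, so [p] is its only possible prime. *)
  apply: (Burnside_solubilizer_sol (q := p) (r := p) sylX sNC (cycle_id x)).
  move=> Q coQ sQX s' /=; rewrite mem_primes => /and3P[pr_s' _ s'Q].
  have sQN: Q \subset N by rewrite -SN (subset_trans _ sQX) // mulG_subl.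
  rewrite !inE (primeN s') ?eqxx // ?(dvdn_trans s'Q) ?cardSg //.
  apply: contraTneq coQ => s3; rewrite ox coprime_sym prime_coprime // negbK.
  by rewrite -s3.
(* The index is not 1 and divides [totient 3], which is 2. *)
have i2: #|N : 'C_N(X)| = 2.
  apply/prime_nt_dvdP; rewrite ?index_cent_norm_neq1 //.
  by have := index_cent_norm_cycle; rewrite ox totient_prime.
have oNC := Lagrange (subsetIl N 'C(X)); rewrite i2 in oNC.
have p2: p = 2 by apply/esym/primeN; rewrite // -oNC dvdn_mull.
have SN: S = N by apply: SN_p; rewrite p2 -oNC dvdn_mull.
have oS6: #|S| = 6 by rewrite oS p2.
apply: (order3_norm6_sol ox SN oS6).
have oN6: #|N| = 6 by rewrite -SN.
by apply/eqP; rewrite -(eqn_pmul2r (isT : 0 < 2)); apply/eqP/(etrans oNC).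
Qed.

End Cases.

Theorem proposition4p8 (gT : finGroupType) (G : {group gT}) (x : gT) (p : nat)
    (insolG : ~~ solvable G) (Gx : x \in G) (pr_p : prime p)
    (cardSol : #|solubilizer G x| = (3 * p)%N) :
  [/\ #[x] = p, p = 1 %[mod 3] & solubilizer G x = 'N_G(<[x]>)].
Proof.
have SnG: solubilizer G x <> G.
  move=> SG; case/negP: insolG.
  by apply: (card_prime_mul_sol (isT : prime 3) pr_p); rewrite -cardSol SG.
(* For [x = 1] the normaliser of [<[x]>] is all of [G], so [S] would be [G]. *)
have x_neq1: #[x] != 1%N.
  apply/eqP=> /eqP; rewrite order_eq1 => /eqP x1; apply: SnG; apply/eqP.
  rewrite eqEsubset solubilizer_sub /=.
  by have := norm_cycle_sub_solubilizer G x; rewrite {1}x1 cycle1 norm1 setIT.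
have := order_dvd_solubilizer Gx; rewrite cardSol.
have [ox | p_neq] := eqVneq #[x] p.
  by move=> _; have [] := solubilizer_order_p Gx insolG pr_p ox cardSol.
(* If [p] divides [#[x]], then [#[x]] is [3 * p] and [S] is just [<[x]>]; otherwise [#[x]] is 3. *)
have [p_dv | np] := boolP (p %| #[x]).
  case/dvdnP: p_dv => m om; rewrite om dvdn_pmul2r ?prime_gt0 // => m3.
  have m_neq1: m != 1%N by apply: contraNneq p_neq => m1; rewrite om m1 mul1n.
  have {m3}m_3: m = 3 by apply/prime_nt_dvdP.
  case/negP: insolG; apply: (solubilizer_cycle_sol Gx).
  apply/eqP; rewrite eq_sym eqEcard cardSol -orderE om m_3 leqnn andbT.
  exact: subset_trans (cycle_sub_norm Gx) (norm_cycle_sub_solubilizer G x).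
rewrite Gauss_dvdl; last by rewrite coprime_sym prime_coprime.
case/(prime_nt_dvdP (isT : prime 3) x_neq1)=> ox.
case/negP: insolG; apply: (solubilizer_order3 Gx pr_p ox cardSol).
by rewrite -ox eq_sym.
Qed.
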